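(* Let $b>1$ and $n\in\mathbb N$. Then $\delta_{x_n}^{u_n}$, with $x_{n,j}=b^{(2j-1)/(2n)}$ for all $j=1,\ldots,n$, is the unique best $d_{\sf K}$-approximation of $\beta_b$, and also the unique best uniform $d_{\sf K}$-approximation of $\beta_b$. Moreover, the best $d_{\sf K}$-approximation $\delta_\bullet^{\bullet,n}$ satisfies $d_{\sf K}(\beta_b,\delta_\bullet^{\bullet,n})=\frac12n^{-1}$.
   Context: For $b>1$, $\beta_b$ is the Borel probability measure on $\mathbb I=[1,b]$ with $\beta_b([1,s])=\log s/\log b$ for all $s\in[1,b[$. For Borel probability measures $\mu,\nu$ on $[1,b]$ with distribution functions $F_\mu,F_\nu$, the Kolmogorov distance is $d_{\sf K}(\mu,\nu)=\sup_{x\in\mathbb R}|F_\mu(x)-F_\nu(x)|$. For $n\in\mathbb N$: $\Xi_n=\{x\in[1,b]^n:x_1\le\ldots\le x_n\}$, $\Pi_n=\{p\in\mathbb R^n:p_j\ge0,\sum_{j=1}^np_j=1\}$, $u_n=(n^{-1},\ldots,n^{-1})\in\Pi_n$, $\delta_x^p=\sum_{j=1}^np_j\delta_{x_j}$ with $\delta_a$ the Dirac measure at $a$; $x_n=(x_{n,1},\ldots,x_{n,n})\in\Xi_n$. A best $d_{\sf K}$-approximation of $\mu$ (for given $n$), denoted $\delta_\bullet^{\bullet,n}$, is a measure $\delta_x^p$ with $x\in\Xi_n$, $p\in\Pi_n$ such that $d_{\sf K}(\mu,\delta_x^p)\le d_{\sf K}(\mu,\delta_y^q)$ for all $y\in\Xi_n$,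 $q\in\Pi_n$. A best uniform $d_{\sf K}$-approximation of $\mu$ is a measure $\delta_x^{u_n}$, $x\in\Xi_n$, with $d_{\sf K}(\mu,\delta_x^{u_n})\le d_{\sf K}(\mu,\delta_y^{u_n})$ for all $y\in\Xi_n$. *)

(* Defs.v *)
From HB Require Import structures.
From mathcomp Require Import all_boot all_order all_algebra.
From mathcomp Require Import all_classical all_reals all_analysis.
From mathcomp Require Import measurable_realfun.
Set Implicit Arguments.
Unset Strict Implicit.
Unset Printing Implicit Defensive.
Import Order.TTheory GRing.Theory Num.Theory.
Import numFieldNormedType.Exports.
Local Open Scope classical_set_scope.
Local Open Scope ring_scope.

(** Borel probability measures on [[1, b]] are represented as probability
    measures on [R] that give mass 1 to [`[1, b]]. *)

Notation borel_prob R := (probability (measurableTypeR R) R).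

(** Equality of Borel measures.  The underlying functions are defined on all
    subsets of [R], so Leibniz equality would also compare the irrelevant values
    on nonmeasurable sets. *)
Definition same_measure (R : realType) (mu nu : borel_prob R) : Prop :=
  forall A : set (measurableTypeR R), measurable A -> mu A = nu A.

Definition is_benford (R : realType) (b : R) (beta : borel_prob R) : Prop :=
  beta `[1, b]%classic = 1%E /\
  forall s : R, 1 <= s < b -> beta `[1, s]%classic = (ln s / ln b)%:E.

Definition borel_id (R : realType) : measurableTypeR R -> R := idfun.

HB.instance Definition _ (R : realType) :=
  @isMeasurableFun.Build _ _ _ _ (@borel_id R) (@measurable_id _ _ setT).

(** The distribution function of a measure is the [cdf] of the identity random
    variable. *)
Definition distr_fun (R : realType) (mu : borel_prob R) (x : R) : R :=
  fine (cdf (@borel_id R : {RV mu >-> R}) x).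

Lemma distr_funE (R : realType) (mu : borel_prob R) (x : R) :
  distr_fun mu x = fine (mu `]-oo, x]%classic).
Proof. by []. Qed.

(** The real-valued [sup] is not a junk value: the set is nonempty and bounded
    by 1. *)
Definition dK (R : realType) (mu nu : borel_prob R) : R :=
  sup [set `|distr_fun mu x - distr_fun nu x| | x in [set: R]].

Definition Xi (R : realType) (b : R) (n : nat) (x : 'I_n -> R) : Prop :=
  (forall j, 1 <= x j <= b) /\ {homo x : i j / (i <= j)%N >-> i <= j}.

Record simplex (R : realType) (n : nat) := Simplex {
  weight :> 'I_n -> R ;
  weight_ge0 : forall j, 0 <= weight j ;
  weight_sum1 : \sum_(j < n) weight j = 1 }.

Section uniform_weights.
Variables (R : realType) (n : nat) (hn : (0 < n)%N).

Let w : 'I_n -> R := fun=> n%:R^-1.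

Let w_ge0 j : 0 <= w j.
Proof. by rewrite invr_ge0. Qed.

Let w_sum1 : \sum_(j < n) w j = 1.
Proof.
by rewrite sumr_const card_ord -[LHS]mulr_natr mulVf// pnatr_eq0 -lt0n.
Qed.

Definition uniform_weights : simplex R n := Simplex w_ge0 w_sum1.

End uniform_weights.

Section discrete.
Context (R : realType) (n : nat).
Variables (x : 'I_n -> R) (p : simplex R n).

Definition discrete (A : set (measurableTypeR R)) : \bar R :=
  (\sum_(j < n) (p j)%:E * \d_(x j) A)%E.

Let discrete0 : discrete set0 = 0%E.
Proof. by rewrite /discrete big1// => j _; rewrite measure0 mule0. Qed.

Let discrete_ge0 A : (0 <= discrete A)%E.
Proof.
by apply: sume_ge0 => j _; rewrite mule_ge0// lee_fin weight_ge0.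
Qed.

Let discrete_sigma_additive : semi_sigma_additive discrete.
Proof.
move=> F mF tF mUF.
have pE j : (p j)%:E = (NngNum (weight_ge0 p j))%:num%:E by [].
rewrite [X in _ --> X](_ : _ =
    lim ((fun k => \sum_(0 <= i < k) discrete (F i))%E @ \oo)).
  by apply: is_cvg_ereal_nneg_natsum => k _; exact: discrete_ge0.
rewrite /discrete nneseries_sum//; last first.
  by move=> j i _; rewrite mule_ge0// lee_fin weight_ge0.
apply: eq_bigr => /= j _; rewrite pE.
exact: (measure_semi_bigcup (mscale (NngNum (weight_ge0 p j)) (dirac (x j)))).
Qed.

HB.instance Definition _ := isMeasure.Build _ _ _ discrete
  discrete0 discrete_ge0 discrete_sigma_additive.

Let discrete_setT : discrete [set: _] = 1%E.
Proof.
rewrite /discrete; under eq_bigr do rewrite diracT mule1.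
by rewrite sumEFin weight_sum1.
Qed.

HB.instance Definition _ := @Measure_isProbability.Build _ _ R
  discrete discrete_setT.

End discrete.

Definition best_approx (R : realType) (b : R) (n : nat)
    (mu nu : borel_prob R) : Prop :=
  (exists (x : 'I_n -> R) (p : simplex R n),
     Xi b x /\ same_measure nu (discrete x p)) /\
  forall (y : 'I_n -> R) (q : simplex R n),
    Xi b y -> dK mu nu <= dK mu (discrete y q).

Definition best_uniform_approx (R : realType) (b : R) (n : nat) (hn : (0 < n)%N)
    (mu nu : borel_prob R) : Prop :=
  (exists x : 'I_n -> R,
     Xi b x /\ same_measure nu (discrete x (uniform_weights R hn))) /\
  forall y : 'I_n -> R,
    Xi b y -> dK mu nu <= dK mu (discrete y (uniform_weights R hn)).

(** The [is_benford] measure exists: it is the law of [b ^ U] with [U] uniform on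
    [[0, 1]]. *)
Section benford_exists.
Variables (R : realType) (b : R).

Let X (t : measurableTypeR R) : measurableTypeR R := expR (t * ln b).

Let mX : measurable_fun setT X.
Proof.
apply: measurableT_comp; first exact: measurable_expR.
exact: mulrr_measurable.
Qed.

Lemma benford_exists : 1 < b -> exists beta : borel_prob R, is_benford b beta.
Proof.
move=> b1; have lb : 0 < ln b by rewrite ln_gt0.
pose P : borel_prob R := uniform_prob (@ltr01 R).
have key s : 1 <= s <= b -> P (X @^-1` `[1, s]%classic) = (ln s / ln b)%:E.
  move=> /andP[s1 sb]; have s0 : 0 < s by exact: lt_le_trans s1.
  have ls0 : 0 <= ln s by rewrite ln_ge0.
  have lsb : ln s <= ln b by rewrite ler_ln// posrE// (lt_trans _ b1).
  have -> : X @^-1` `[1, s]%classic = `[0, ln s / ln b]%classic.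
    apply/funext => t /=; rewrite !in_itv/= /X ler_pdivlMr//.
    rewrite -(ler_expR (t * ln b)) lnK ?posrE// -{1}(expR0 R) ler_expR.
    by rewrite pmulr_lge0.
  rewrite /P/= /uniform_prob.
  rewrite (eq_integral (fun=> 1%:E)); last first.
    move=> t; rewrite inE/= in_itv/= => /andP[t0 ts].
    rewrite /uniform_pdf t0 (le_trans ts) ?subr0 ?invr1//.
    by rewrite ler_pdivrMr// mul1r.
  rewrite integral_cst//= lebesgue_measure_itv/= lte_fin.
  case: ifPn => [_|]; first by rewrite mul1e sube0.
  by rewrite -leNgt => h; rewrite mule0; congr EFin; apply/eqP;
    rewrite eq_le h divr_ge0// ltW.
exists (distribution P (mfun_Sub (mem_set mX))); split.
  by apply: etrans (key b _) _; rewrite ?lexx ?ltW// divff// gt_eqF.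
by move=> s /andP[s1 sb]; apply: key; rewrite s1 ltW.
Qed.

End benford_exists.

(* Main.v *)
Require Import Defs.
From mathcomp Require Import all_boot all_order all_algebra.
From mathcomp Require Import all_classical all_reals all_analysis.
From mathcomp Require Import ring lra zify.
Set Implicit Arguments.
Unset Strict Implicit.
Unset Printing Implicit Defensive.
Import Order.TTheory GRing.Theory Num.Theory.
Import numFieldNormedType.Exports.
Local Open Scope classical_set_scope.
Local Open Scope ring_scope.

(** Write [F] for the distribution function of [beta], which is continuous, and
    [G] for that of an approximation with atoms [y_0 <= ... <= y_(n-1)] whose
    distance to [F] is at most [d].  The function [G] is [0] before [y_0], is
    constant between consecutive atoms and is [1] from [y_(n-1)] on.  Since [F]
    stays within [d] of [G] and has no jumps,
    - [F] is at most [d] at the first atom ([level_first_atom]),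
    - [F] grows by at most [2 d] from one atom to the next ([level_next_atom]),
    - [F] is at least [1 - d] at the last atom ([level_last_atom]).
    Climbing from [0] to [1] thus takes [1 <= d + (n - 1) 2 d + d = 2 n d], which
    is the lower bound [d >= 1 / (2 n)] ([error_ge]).

    If [d = 1 / (2 n)] there is no slack in this count, so every step is an
    equality: [F] takes the value [(2 k + 1) / (2 n)] at [y_k]
    ([level_of_optimal]).  In particular the atoms are distinct, and comparing
    [G] with [F] at the two ends of each gap between atoms leaves
    [(k + 1) / n] as the only possible value of [G] at [y_k]; hence all weights
    are [1 / n] ([weight_of_optimal]).  As [F] is injective on [[1, b]], the atoms
    are the points [b ^ ((2 k + 1) / (2 n))].

    Conversely these atoms with equal weights attain the bound
    ([benford_near_midpoints]): [n G t] counts the half-integers [k + 1/2] that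
    are at most [n F t], and this count differs from [n F t] by at most [1/2].

    The lower bound and the rigidity hold for arbitrary weights, and the optimal
    measure has uniform weights, so it is the unique minimizer in both classes. *)

(** * Step distribution functions near a continuous function *)

(** A bound on the left of [z] persists at [z]; this is where continuity of the
    approximated distribution function enters. *)
Lemma le_of_left_le (R : realType) (F : R -> R) : continuous F ->
  forall a z c, a < z -> (forall t, a <= t < z -> F t <= c) -> F z <= c.
Proof.
move=> F_cont a z c az Fc; apply: (@cvgr_to_le _ z^'- _ R F).
  exact/cvg_at_left_filter/F_cont.
near=> t; apply: Fc; apply/andP; split; near: t.
- exact: nbhs_left_ge.
- exact: nbhs_left_lt.
Unshelve. all: by end_near. Qed.

Section step_function.
Variables (R : realType) (n : nat).

Definition step (y : 'I_n -> R) (q : simplex R n) (t : R) : R :=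
  \sum_(j < n) q j * (y j <= t)%R%:R.

Variables (y : 'I_n -> R) (q : simplex R n).
Hypothesis y_homo : {homo y : i j / (i <= j)%N >-> i <= j}.

Lemma step_lt_atoms t : (forall j, t < y j) -> step y q t = 0.
Proof. by move=> ty; rewrite /step big1// => j _; rewrite leNgt ty mulr0. Qed.

Lemma step_ge_atoms t : (forall j, y j <= t) -> step y q t = 1.
Proof.
by move=> yt; rewrite -(weight_sum1 q); apply: eq_bigr => j _; rewrite yt mulr1.
Qed.

Lemma step_between k t : (forall j : 'I_n, (j < k)%N -> y j <= t) ->
  (forall j : 'I_n, (k <= j)%N -> t < y j) ->
  step y q t = \sum_(j < n | (j < k)%N) q j.
Proof.
move=> yt ty; rewrite [RHS]big_mkcond; apply: eq_bigr => j _.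
by case: ltnP => [/yt->|/ty]; rewrite ?mulr1// leNgt => ->; rewrite mulr0.
Qed.

Section approximation.
Variables (F : R -> R) (d : R).
Hypothesis F_cont : continuous F.
Hypothesis F_near : forall t, `|F t - step y q t| <= d.

Let F_le t : F t <= step y q t + d.
Proof. by have := F_near t; rewrite ler_norml; lra. Qed.

Let F_ge t : step y q t - d <= F t.
Proof. by have := F_near t; rewrite ler_norml; lra. Qed.

Lemma level_first_atom (j : 'I_n) : nat_of_ord j = 0%N -> F (y j) <= d.
Proof.
move=> j0; apply: (@le_of_left_le _ F F_cont (y j - 1)); first by lra.
move=> t /andP[_ tj]; have := F_le t; rewrite step_lt_atoms ?add0r// => i.
by apply: lt_le_trans tj _; apply: y_homo; rewrite j0.
Qed.

Lemma level_last_atom (j : 'I_n) : nat_of_ord j = n.-1 -> 1 - d <= F (y j).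
Proof.
move=> jn; rewrite -(@step_ge_atoms (y j)); first exact: F_ge.
by move=> i; apply: y_homo; rewrite jn -ltnS prednK ?(leq_trans _ (ltn_ord i)).
Qed.

(** Both values of [F] are within [d] of the constant value of the step function
    on the gap between the two atoms. *)
Lemma level_next_atom (i j : 'I_n) :
  j = i.+1 :> nat -> F (y j) <= F (y i) + 2 * d.
Proof.
move=> ij; have := y_homo (_ : (i <= j)%N); rewrite ij => /(_ (leqnSn _)).
rewrite le_eqVlt => /orP[/eqP <-|yij].
  (* Coinciding atoms leave no gap, and it suffices that [d] is nonnegative. *)
  by have := F_near (y i); have := normr_ge0 (F (y i) - step y q (y i)); lra.
apply: (le_of_left_le F_cont yij) => t /andP[yit tyj].
have same : step y q t = step y q (y i).
  rewrite !(@step_between i.+1)// => k ik.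
  - exact: y_homo.
  - by apply: lt_le_trans yij _; apply: y_homo; rewrite ij.
  - by apply: le_trans yit; exact: y_homo.
  - by apply: lt_le_trans tyj _; apply: y_homo; rewrite ij.
by have := F_le t; have := F_ge (y i); rewrite same; lra.
Qed.

Lemma level_atom_le (j : 'I_n) : F (y j) <= (2 * j%:R + 1) * d.
Proof.
case: j => k hk /=; elim: k hk => [|k IH] hk.
  by rewrite mulr0 add0r mul1r; exact: level_first_atom.
have := IH (ltnW hk).
have := @level_next_atom (Ordinal (ltnW hk)) (Ordinal hk) erefl.
by rewrite -[k.+1%:R]natr1; lra.
Qed.

(** Descending from the last atom, the [n - j - 1] gaps above [y_j] cost at most
    [2 d] each. *)
Lemma level_atom_ge (j : 'I_n) : 1 - (2 * (n%:R - j%:R) - 1) * d <= F (y j).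
Proof.
have n0 : (0 < n)%N by apply: leq_ltn_trans (ltn_ord j).
move: j; suff H k : forall j : 'I_n, (j + k)%N = n.-1 ->
    1 - (2 * k%:R + 1) * d <= F (y j).
  move=> j; have := H (n.-1 - j)%N j.
  rewrite subnKC ?natrB -1?ltnS ?prednK// => /(_ erefl).
  by rewrite -[in n%:R](prednK n0) -[n.-1.+1%:R]natr1; lra.
elim: k => [|k IH] j jk.
  by rewrite mulr0 add0r mul1r; apply: level_last_atom; rewrite -jk addn0.
have jn : (j.+1 < n)%N by lia.
have := IH (Ordinal jn); rewrite /= addSnnS => /(_ jk).
have := @level_next_atom j (Ordinal jn) erefl.
by rewrite -[k.+1%:R]natr1; lra.
Qed.

(** The ascending and the descending bound meet at the first atom. *)
Lemma error_ge : (0 < n)%N -> 2^-1 * n%:R^-1 <= d.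
Proof.
move=> n0; have nR : 0 < n%:R :> R by rewrite ltr0n.
rewrite -invfM -div1r ler_pdivrMr ?mulr_gt0//.
have := level_atom_le (Ordinal n0); have := level_atom_ge (Ordinal n0).
by move=> /=; nra.
Qed.

Section optimal.
Hypothesis d_opt : d = 2^-1 * n%:R^-1.

(** For this [d] the ascending and the descending bound coincide. *)
Lemma level_of_optimal (j : 'I_n) : F (y j) = (2 * j%:R + 1) / (2 * n%:R).
Proof.
have nR : n%:R != 0 :> R.
  by rewrite pnatr_eq0 -lt0n (leq_ltn_trans _ (ltn_ord j)).
apply/eqP; rewrite eq_le; apply/andP; split.
  by apply: le_trans (level_atom_le j) _; rewrite d_opt invfM.
apply: le_trans (level_atom_ge j); rewrite d_opt le_eqVlt.
by apply/orP; left; apply/eqP; field.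
Qed.

Let y_lt (i j : 'I_n) : (i < j)%N -> y i < y j.
Proof.
move=> ij; rewrite lt_neqAle y_homo 1?ltnW// andbT; apply/eqP => yij.
have := level_of_optimal i; rewrite yij level_of_optimal.
have nR : 0 < (2 * n%:R)^-1 :> R.
  by rewrite invr_gt0 mulr_gt0// ltr0n (leq_ltn_trans _ (ltn_ord j)).
move/(mulIf (lt0r_neq0 nR)) => e.
have : j%:R = i%:R :> R by lra.
by move/eqP; rewrite eqr_nat => /eqP e'; rewrite e' ltnn in ij.
Qed.

(** The upper bound comes from [F] at the atom of index [k - 1], the lower bound
    from the left limit of [F] at the atom of index [k], or from the total mass
    when [k = n]. *)
Lemma cumul_of_optimal k : (k <= n)%N ->
  \sum_(j < n | (j < k)%N) q j = k%:R / n%:R.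
Proof.
case: k => [|k] kn; first by rewrite mul0r big1.
pose i := Ordinal kn.
have n0 : (0 < n)%N := leq_ltn_trans (leq0n k) kn.
have nR : n%:R != 0 :> R by rewrite pnatr_eq0 -lt0n.
have before (j : 'I_n) : (j < k.+1)%N -> y j <= y i by move=> jk; exact: y_homo.
apply/eqP; rewrite eq_le; apply/andP; split.
  have := F_ge (y i); rewrite (@step_between k.+1)//; last exact: (@y_lt i).
  rewrite level_of_optimal d_opt/= => H.
  have -> : k.+1%:R / n%:R = (2 * k%:R + 1) / (2 * n%:R) + 2^-1 * n%:R^-1 :> R.
    by rewrite -[k.+1%:R]natr1; field.
  lra.
have [kn1|kn1] := ltnP k.+1 n; last first.
  have kE : k.+1 = n by lia.
  rewrite kE divff// -(weight_sum1 q) [leRHS](eq_bigl xpredT)// => j.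
  exact: ltn_ord.
have := @le_of_left_le _ F F_cont (y i) (y (Ordinal kn1))
  (\sum_(j < n | (j < k.+1)%N) q j + d) (@y_lt i (Ordinal kn1) (ltnSn k)).
rewrite level_of_optimal d_opt/=.
have -> : (2 * k.+1%:R + 1) / (2 * n%:R) = k.+1%:R / n%:R + 2^-1 / n%:R :> R.
  by field.
rewrite lerD2r; apply => t /andP[yit tyj]; rewrite -d_opt.
rewrite -(@step_between k.+1 t)// => j jk.
  by apply: le_trans (before _ jk) _.
by apply: lt_le_trans tyj _; exact: y_homo.
Qed.

Lemma weight_of_optimal (j : 'I_n) : q j = n%:R^-1.
Proof.
have := cumul_of_optimal (ltn_ord j); rewrite (bigD1 j)//=.
rewrite (eq_bigl (fun i : 'I_n => (i < j)%N)); last first.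
  by move=> i; rewrite ltnS ltn_neqAle andbC.
rewrite cumul_of_optimal 1?ltnW// -[j.+1%:R]natr1 mulrDl mul1r; lra.
Qed.

End optimal.
End approximation.
End step_function.

(** * Rounding to the nearest integer *)

(** The function counting half-integers in [[0, v]] rounds [v] to a nearest
    integer. *)
Lemma count_half_integers (R : realType) (n : nat) (v : R) : 0 <= v <= n%:R ->
  `|v - \sum_(j < n) (j%:R + 2^-1 <= v)%R%:R| <= 2^-1.
Proof.
elim: n => [|n IH] /andP[v0 vn].
  have -> : v = 0 by apply/le_anti/andP.
  by rewrite big_ord0 subrr normr0; lra.
rewrite big_ord_recr/=; have [vn'|nv] := lerP v n%:R.
  have -> : (n%:R + 2^-1 <= v) = false by apply/negbTE; rewrite -ltNge; lra.
  by rewrite addr0 IH ?v0.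
rewrite (eq_bigr (fun=> 1)) => [|j _]; last first.
  suff -> : j%:R + 2^-1 <= v by [].
  have : j.+1%:R <= n%:R :> R by rewrite ler_nat.
  by rewrite -natr1; lra.
rewrite sumr_const card_ord; rewrite -natr1 in vn.
by case: (lerP (n%:R + 2^-1) v) => h; rewrite ler_norml /=; lra.
Qed.

(** * Distribution functions and the Kolmogorov distance *)

Lemma distr_fun_bounds (R : realType) (mu : borel_prob R) t :
  0 <= distr_fun mu t <= 1.
Proof.
rewrite distr_funE fine_ge0//= -[1]/(fine 1%E) fine_le ?fin_num_measure//.
by apply: probability_le1.
Qed.

Lemma dist_le_dK (R : realType) (mu nu : borel_prob R) t :
  `|distr_fun mu t - distr_fun nu t| <= dK mu nu.
Proof.
apply: ub_le_sup; last by exists t.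
exists 1 => _ [s _ <-]; rewrite ler_norml.
by have := distr_fun_bounds mu s; have := distr_fun_bounds nu s; lra.
Qed.

Lemma dK_le (R : realType) (mu nu : borel_prob R) d :
  (forall t, `|distr_fun mu t - distr_fun nu t| <= d) -> dK mu nu <= d.
Proof.
move=> H; apply: ge_sup => [|_ [t _ <-]//].
by exists `|distr_fun mu 0 - distr_fun nu 0|, 0.
Qed.

Lemma eq_dK (R : realType) (mu nu nu' : borel_prob R) :
  same_measure nu nu' -> dK mu nu = dK mu nu'.
Proof.
move=> e; have eF t : distr_fun nu t = distr_fun nu' t by rewrite !distr_funE e.
by congr sup; apply/seteqP; split=> _ [t _ <-]; exists t; rewrite ?eF.
Qed.

Lemma distr_fun_discrete (R : realType) n (y : 'I_n -> R) (q : simplex R n) t :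
  distr_fun (discrete y q) t = step y q t.
Proof.
rewrite distr_funE /= /discrete /step.
under eq_bigr do rewrite diracE -EFinM.
rewrite sumEFin /=; apply: eq_bigr => j _.
by congr (_ * _%:R); congr nat_of_bool; apply/idP/idP; rewrite inE/= in_itv.
Qed.

Lemma eq_discrete (R : realType) n (y z : 'I_n -> R) (p q : simplex R n) :
  y =1 z -> p =1 q -> same_measure (discrete y p) (discrete z q).
Proof. by move=> yz pq A _; apply: eq_bigr => j _; rewrite yz pq. Qed.

(** * The distribution function of the Benford measure *)

Lemma probability_setI_full (d : measure_display) (T : measurableType d)
    (R : realType) (P : probability T R) (A B : set T) :
  measurable A -> measurable B -> P B = 1%E -> P (A `&` B) = P A.
Proof.
move=> mA mB PB; rewrite [RHS](@measureDI _ _ _ P _ _ mA mB).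
rewrite [X in (X + _)%E](_ : _ = 0%E) ?add0e//.
apply: (@subset_measure0 _ _ _ P _ (~` B)).
- exact: measurableD.
- exact: measurableC.
- by move=> x [].
- by apply: etrans (probability_setC P mB) _; rewrite PB subee.
Qed.

Section benford.
Variables (R : realType) (b : R).
Hypothesis b1 : 1 < b.

(** Clamping [t] to [[1, b]] gives one formula on the whole line, from which
    continuity is immediate. *)
Definition benford_cdf (t : R) : R := ln (Num.min (Num.max t 1) b) / ln b.

Let lnb : 0 < ln b. Proof. by rewrite ln_gt0. Qed.

Lemma benford_cdf_lt1 t : t < 1 -> benford_cdf t = 0.
Proof.
move=> t1; rewrite /benford_cdf max_r ?min_l ?ln1 ?mul0r//; exact: ltW.
Qed.

Lemma benford_cdfE t : 1 <= t <= b -> benford_cdf t = ln t / ln b.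
Proof. by move=> /andP[t1 tb]; rewrite /benford_cdf max_l// min_l. Qed.

Lemma benford_cdf_geb t : b <= t -> benford_cdf t = 1.
Proof.
move=> bt; rewrite /benford_cdf max_l ?min_r//; last first.
  exact: le_trans (ltW b1) bt.
by rewrite divff// gt_eqF.
Qed.

Lemma benford_cdf_bounds t : 0 <= benford_cdf t <= 1.
Proof.
case: (ltP t 1) => [/benford_cdf_lt1 ->|t1]; first by rewrite lexx ler01.
case: (leP b t) => [/benford_cdf_geb ->|tb]; first by rewrite ler01 lexx.
have t0 : 0 < t := lt_le_trans ltr01 t1.
rewrite benford_cdfE ?t1 ?(ltW tb)// (divr_ge0 (ln_ge0 t1) (ltW lnb))//=.
by rewrite ler_pdivrMr// mul1r ler_ln ?posrE ?(ltW tb)// (lt_trans t0 tb).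
Qed.

Lemma benford_cdf_continuous : continuous benford_cdf.
Proof.
move=> t; apply: cvgM; last exact: cvg_cst.
have cmax : {for t, continuous (fun s : R => Num.max s 1)}.
  apply: (@continuous_max R R id (cst 1)); [exact: cvg_id|exact: cvg_cst].
have cclamp : {for t, continuous (fun s : R => Num.min (Num.max s 1) b)}.
  by apply: (@continuous_min R R _ (cst b) t cmax); exact: cvg_cst.
apply: (continuous_comp cclamp); apply: continuous_ln.
by rewrite lt_min lt_max ltr01 orbT (lt_trans _ b1).
Qed.

Lemma distr_fun_benford (beta : borel_prob R) : is_benford b beta ->
  distr_fun beta =1 benford_cdf.
Proof.
move=> [bT bs] t; rewrite distr_funE.
rewrite -(probability_setI_full _ _ bT)//.
case: (ltP t 1) => [t1|t1].
  rewrite benford_cdf_lt1// (_ : _ `&` _ = set0) ?measure0//.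
  apply/seteqP; split => // s /=; rewrite !in_itv/= => -[st /andP[s1 _]].
  by have := le_lt_trans (le_trans s1 st) t1; rewrite ltxx.
case: (ltP t b) => [tb|tb].
  rewrite benford_cdfE ?t1 ?ltW// (_ : _ `&` _ = `[1, t]%classic) ?bs ?t1//.
  apply/seteqP; split => s /=; rewrite !in_itv/=.
    by move=> [-> /andP[->]].
  by move=> /andP[-> st]; rewrite st (le_trans st) ?ltW.
rewrite benford_cdf_geb// (_ : _ `&` _ = `[1, b]%classic) ?bT//.
apply/seteqP; split => s /=; rewrite !in_itv/=; first by case.
by move=> /andP[-> sb]; rewrite sb (le_trans sb).
Qed.

Lemma benford_cdf_inj : {in `[1, b] &, injective benford_cdf}.
Proof.
move=> s t; rewrite !in_itv/= => sb tb; rewrite !benford_cdfE//.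
have [/andP[s1 _] /andP[t1 _]] := (sb, tb).
move=> /(mulIf (invr_neq0 (lt0r_neq0 lnb))); apply: ln_inj.
  by rewrite posrE (lt_le_trans ltr01).
by rewrite posrE (lt_le_trans ltr01).
Qed.

(** The equivalence holds for all [t], also outside [[1, b]], but only for such
    levels: as the distribution function is [0] on the left and [1] on the right,
    it fails at nonpositive [t] if [u <= 0] and at large [t] if [u > 1]. *)
Lemma benford_quantile u t : 0 < u < 1 ->
  (b `^ u <= t) = (u <= benford_cdf t).
Proof.
move=> /andP[u0 u1].
have b0 : 0 < b by apply: lt_trans b1.
have ub : b `^ u < b.
  by rewrite -{2}(powRr1 (ltW b0)) -ltr_ln ?posrE ?powR_gt0// !ln_powR ltr_pM2r.
have uge1 : 1 < b `^ u.
  by rewrite -ltr_ln ?posrE ?powR_gt0// ln_powR ln1 mulr_gt0.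
case: (ltP t 1) => [t1|t1].
  by rewrite benford_cdf_lt1// (lt_geF u0) lt_geF// (lt_trans t1).
case: (leP t b) => [tb|tb].
  rewrite benford_cdfE ?t1// ler_pdivlMr// -ln_powR ler_ln ?posrE ?powR_gt0//.
  exact: lt_le_trans t1.
by rewrite benford_cdf_geb ?(ltW u1) ?(ltW (lt_trans ub tb))// ltW.
Qed.

(** * The quantiles of the midpoint levels *)

Section midpoints.
Variables (n : nat) (hn : (0 < n)%N).

Definition midpoint (j : 'I_n) : R := b `^ ((2 * j.+1%:R - 1) / (2 * n%:R)).

Let nR : 0 < n%:R :> R. Proof. by rewrite ltr0n. Qed.

Lemma midpoint_level (j : 'I_n) :
  (2 * j.+1%:R - 1) / (2 * n%:R) = (j%:R + 2^-1) / n%:R :> R.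
Proof. by rewrite -natr1; field; rewrite gt_eqF. Qed.

Lemma midpoint_level_bounds (j : 'I_n) :
  0 < ((2 * j.+1%:R - 1) / (2 * n%:R) : R) < 1.
Proof.
rewrite midpoint_level divr_gt0 ?ltr_pdivrMr ?ltr_wpDl ?invr_gt0//= mul1r.
have : j.+1%:R <= n%:R :> R by rewrite ler_nat.
by rewrite -natr1; lra.
Qed.

Lemma midpoint_Xi : Xi b midpoint.
Proof.
have b0 : 0 < b by apply: lt_trans b1.
split=> [j|i j ij].
  have /andP[l0 l1] := midpoint_level_bounds j.
  apply/andP; split.
    by rewrite -(powRr0 b) ler_powR// ltW.
  by rewrite -[leRHS](powRr1 (ltW b0)) ler_powR// ltW.
rewrite /midpoint ler_powR ?(ltW b1)// !midpoint_level ler_pM2r ?invr_gt0//.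
by rewrite lerD2r ler_nat.
Qed.

Lemma benford_cdf_midpoint (j : 'I_n) :
  benford_cdf (midpoint j) = (2 * j%:R + 1) / (2 * n%:R).
Proof.
rewrite benford_cdfE; last by case: midpoint_Xi.
rewrite /midpoint ln_powR mulfK ?gt_eqF// -natr1; congr (_ / _); lra.
Qed.

(** By [benford_quantile], [n] times the step function counts the half-integers
    [j + 1/2] that are at most [n * benford_cdf t]. *)
Lemma benford_near_midpoints t :
  `|benford_cdf t - step midpoint (uniform_weights R hn) t| <= 2^-1 * n%:R^-1.
Proof.
have -> : step midpoint (uniform_weights R hn) t =
    (\sum_(j < n) (j%:R + 2^-1 <= n%:R * benford_cdf t)%R%:R) / n%:R.
  rewrite mulr_suml; apply: eq_bigr => j _; rewrite mulrC /=; congr (_%:R * _).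
  rewrite /midpoint benford_quantile ?midpoint_level_bounds//.
  by rewrite midpoint_level ler_pdivrMr// [benford_cdf t * _]mulrC.
set S := \sum_(j < n) _.
have -> : benford_cdf t - S / n%:R = (n%:R * benford_cdf t - S) / n%:R.
  by field; rewrite gt_eqF.
rewrite normrM [`|n%:R^-1|]ger0_norm ?invr_ge0// ler_pM2r ?invr_gt0//.
apply: count_half_integers; have /andP[F0 F1] := benford_cdf_bounds t.
by rewrite mulr_ge0//= ler_piMr.
Qed.

End midpoints.
End benford.

(** * Optimal approximations *)

Section kolmogorov.
Variables (R : realType) (b : R) (n : nat) (beta : borel_prob R).
Hypotheses (b1 : 1 < b) (hn : (0 < n)%N) (hbeta : is_benford b beta).

Let near (y : 'I_n -> R) (q : simplex R n) t :
  `|benford_cdf b t - step y q t| <= dK beta (discrete y q).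
Proof.
rewrite -(distr_fun_benford b1 hbeta) -distr_fun_discrete; exact: dist_le_dK.
Qed.

Lemma dK_ge (y : 'I_n -> R) (q : simplex R n) : Xi b y ->
  2^-1 * n%:R^-1 <= dK beta (discrete y q).
Proof.
move=> [_ yh].
exact: (error_ge yh (@benford_cdf_continuous _ _ b1) (near y q) hn).
Qed.

Lemma dK_midpoint :
  dK beta (discrete (midpoint b (n := n)) (uniform_weights R hn)) =
  2^-1 * n%:R^-1.
Proof.
apply/eqP; rewrite eq_le dK_ge ?andbT; last exact: midpoint_Xi.
apply: dK_le => t; rewrite (distr_fun_benford b1 hbeta) distr_fun_discrete.
exact: benford_near_midpoints.
Qed.

Lemma optimal_is_midpoint (y : 'I_n -> R) (q : simplex R n) : Xi b y ->
  dK beta (discrete y q) <= 2^-1 * n%:R^-1 ->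
  same_measure (discrete y q)
    (discrete (midpoint b (n := n)) (uniform_weights R hn)).
Proof.
move=> Xiy le; have [yb yh] := Xiy.
have opt : dK beta (discrete y q) = 2^-1 * n%:R^-1.
  by apply/eqP; rewrite eq_le le dK_ge.
have cF := @benford_cdf_continuous _ _ b1.
apply: eq_discrete => j; last first.
  exact: (weight_of_optimal yh cF (near y q) opt).
apply: (benford_cdf_inj b1); rewrite ?in_itv/= ?yb//.
  by have [xb _] := midpoint_Xi b1 hn; exact: xb.
rewrite benford_cdf_midpoint//; exact: (level_of_optimal yh cF (near y q) opt).
Qed.

End kolmogorov.

Theorem corollary5p9 (R : realType) (b : R) (n : nat) (hb : 1 < b)
    (hn : (0 < n)%N) (beta : borel_prob R) (hbeta : is_benford b beta) :
  let x : 'I_n -> R := fun j => b `^ ((2 * j.+1%:R - 1) / (2 * n%:R)) in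
  let delta : borel_prob R := discrete x (uniform_weights R hn) in
  [/\ best_approx b n beta delta,
      forall nu : borel_prob R, best_approx b n beta nu -> same_measure nu delta,
      best_uniform_approx b hn beta delta,
      forall nu : borel_prob R,
        best_uniform_approx b hn beta nu -> same_measure nu delta
    & forall nu : borel_prob R,
        best_approx b n beta nu -> dK beta nu = 2^-1 * n%:R^-1].
Proof.
move=> x delta.
have Xix : Xi b x := midpoint_Xi hb hn.
have dKx : dK beta delta = 2^-1 * n%:R^-1 := dK_midpoint hb hn hbeta.
have min_x (y : 'I_n -> R) q :
    Xi b y -> dK beta delta <= dK beta (discrete y q).
  by rewrite dKx; exact: (dK_ge hb hn hbeta).
have optimal_eq (nu : borel_prob R) (y : 'I_n -> R) q :
    Xi b y -> same_measure nu (discrete y q) ->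
    dK beta nu <= dK beta delta -> same_measure nu delta.
  move=> Xiy e; rewrite (eq_dK beta e) dKx.
  move=> /(optimal_is_midpoint hb hn hbeta Xiy) e' A mA.
  by rewrite e// e'.
have best_uniq (nu : borel_prob R) :
    best_approx b n beta nu -> same_measure nu delta.
  by move=> [[y [q [Xiy e]]] le]; apply: optimal_eq e _ => //; exact: le.
split=> //.
- by split; [exists x, (uniform_weights R hn)|].
- by split; [exists x|move=> y; exact: min_x].
- by move=> nu [[y [Xiy e]] le]; apply: optimal_eq e _ => //; exact: le.
- by move=> nu /best_uniq/(eq_dK beta) ->.
Qed.
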